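(* Let $n\ge2$ and let $A$ be a normal $n\times n$ complex matrix with spectrum $\mathrm{Eig}(A)=\{z_1,\ldots,z_n\}$. Let $(\mathbf{u}_1,\ldots,\mathbf{u}_n)$ be the standard basis of $\mathbf{C}^n$ and let $(\mathbf{e}_1,\ldots,\mathbf{e}_n)$ be an orthonormal basis of $\mathbf{C}^n$ consisting of eigenvectors of $A$, with $A\mathbf{e}_j=z_j\mathbf{e}_j$. Then $$\frac{\det(A_{[i]}-zI_{n-1})}{\det(A-zI_n)}=\sum_{j=1}^n\frac{|\langle\mathbf{u}_i,\mathbf{e}_j\rangle|^2}{z_j-z}$$ for $z\in\mathbf{C}\setminus\mathrm{Eig}(A)$ and $1\le i\le n$. In particular, $\mathrm{Eig}(A_{[i]})$ is contained in the convex hull of $\mathrm{Eig}(A)$ for any $i\in\{1,2,\ldots,n\}$.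
   Context: $\mathbf{C}^n$ carries its standard Hermitian scalar product $\langle\cdot,\cdot\rangle$. $\mathrm{Eig}(A)$ is the multiset of eigenvalues of $A$, each repeated according to its algebraic multiplicity. $A_{[i]}$ is the $(n-1)\times(n-1)$ principal submatrix of $A$ obtained by deleting its $i$-th row and $i$-th column. $I_n$ is the $n\times n$ identity matrix. *)

(* Defs.v *)
From HB Require Import structures.
From mathcomp Require Import all_boot all_order all_algebra.
From mathcomp Require Import complex.
From mathcomp Require Import boolp classical_sets reals convex.

Set Implicit Arguments.
Unset Strict Implicit.
Unset Printing Implicit Defensive.

Import Order.TTheory GRing.Theory Num.Theory.

Local Open Scope ring_scope.

(* The multiset of roots of the characteristic polynomial, encoded as a
   sequence: only meaningful up to [perm_eq]. *)
Definition Eig (C : numClosedFieldType) (n : nat) (A : 'M[C]_n) : seq C :=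
  sval (closed_field_poly_normal (char_poly A)).

Lemma char_poly_Eig (C : numClosedFieldType) (n : nat) (A : 'M[C]_n) :
  char_poly A = \prod_(z <- Eig A) ('X - z%:P).
Proof.
rewrite /Eig; case: closed_field_poly_normal => s /= ->.
by rewrite (monicP (char_poly_monic A)) scale1r.
Qed.

Definition principal_submx (C : Type) (n : nat) (A : 'M[C]_n) (i : 'I_n) :
  'M[C]_n.-1 := row' i (col' i A).

(* [dotmx] is the standard Hermitian product of row vectors, antilinear in its
   second argument; vectors are columns here. *)
Definition hdot (C : numClosedFieldType) (n : nat) (u v : 'cV[C]_n) : C :=
  dotmx u^T v^T.

Lemma hdotE (C : numClosedFieldType) (n : nat) (u v : 'cV[C]_n) :
  hdot u v = \sum_(k < n) u k 0 * (v k 0)^*.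
Proof. by rewrite /hdot dotmxE mxE; apply: eq_bigr => k _; rewrite !mxE. Qed.

Definition orthonormal_basis (C : numClosedFieldType) (n : nat)
    (e : 'I_n -> 'cV[C]_n) : Prop :=
  basis_of {:'cV[C]_n} [seq e j | j : 'I_n] /\
  forall j k : 'I_n, hdot (e j) (e k) = (j == k)%:R.

(* [Rcomplex R] is R[i] as a vector space over R, so that [convex_set] is
   convexity with real coefficients. *)
Definition convex_hull (R : realType) (S : set R[i]) : set R[i] :=
  smallest (@convex_set R (Rcomplex R)) S.

(* Main.v *)
(* With P the unitary matrix of the eigenbasis, the inverse of A - w is
   P diag(1 / (z_j - w)) P^*, and Cramer's rule identifies the quotient of
   determinants with its (i, i) entry.  For the inclusion, A_[i] is the
   compression of A to a coordinate hyperplane: a unit eigenvector of A_[i],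
   extended by 0, shows that its eigenvalue lies in the numerical range of A,
   and by the spectral theorem that range consists of convex combinations of
   the eigenvalues of A. *)
Require Import Defs.
From HB Require Import structures.
From mathcomp Require Import all_boot all_order all_algebra.
From mathcomp Require Import complex.
From mathcomp Require Import boolp classical_sets reals convex.
From mathcomp Require Import interval_inference.

Import Order.TTheory GRing.Theory Num.Theory.

Local Open Scope classical_set_scope.
Local Open Scope ring_scope.

(** Multiplying [\adj M *m M = \det M] by [N] on the right gives [\adj M = \det M *: N]; a diagonal
    cofactor carries the sign (-1)^(i+i) = 1. *)
Lemma det_principal_submx_inv (C : comNzRingType) (n : nat) (M N : 'M[C]_n)
    (i : 'I_n) : M *m N = 1%:M ->
  \det (principal_submx M i) = \det M * N i i.
Proof.
move=> MN; have /matrixP/(_ i i) : \adj M = \det M *: N.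
  by rewrite -[LHS]mulmx1 -MN mulmxA mul_adj_mx mul_scalar_mx.
by rewrite !mxE /cofactor -signr_odd oddD addbb mul1r.
Qed.

Lemma principal_submx_compression (C : pzRingType) (n : nat) (A : 'M[C]_n)
    (i : 'I_n) :
  principal_submx A i = row' i 1%:M *m A *m col' i 1%:M.
Proof.
rewrite /principal_submx !row'Esub !col'Esub mul_rowsub_mx mul1mx.
by rewrite mulmx_colsub mulmx1 -mxsubrc -mxsubcr.
Qed.

Lemma principal_submxB_scalar (C : pzRingType) (n : nat) (A : 'M[C]_n) (a : C)
    (i : 'I_n) :
  principal_submx (A - a%:M) i = principal_submx A i - a%:M.
Proof. by apply/matrixP => j k; rewrite !mxE (inj_eq lift_inj). Qed.

Lemma mem_Eig (C : numClosedFieldType) (n : nat) (A : 'M[C]_n) (a : C) :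
  (a \in Eig A) = eigenvalue A a.
Proof. by rewrite eigenvalue_root_char char_poly_Eig root_prod_XsubC. Qed.

Local Open Scope sesquilinear_scope.

Lemma row'1_unitarymx (C : numClosedFieldType) (n : nat) (i : 'I_n) :
  (row' i 1%:M : 'M[C]_(n.-1, n)) \is unitarymx.
Proof.
apply/unitarymxP/matrixP => j k; rewrite !mxE (bigD1 (lift i j)) //= big1.
  by rewrite !mxE eqxx mul1r addr0 (inj_eq lift_inj) eq_sym conjC_nat.
by move=> l lj; rewrite !mxE eq_sym (negbTE lj) mul0r.
Qed.

(** [unitarymx] speaks of rows while the [e j] are columns; for a square matrix, unitarity passes to
    the transpose. *)
Lemma orthonormal_basis_unitarymx (C : numClosedFieldType) (n : nat)
    (e : 'I_n -> 'cV[C]_n) : orthonormal_basis e ->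
  (\matrix_(k, j) e j k 0) \is unitarymx.
Proof.
case=> _ eo; rewrite -trmx_unitary; apply/row_unitarymxP => j k.
by rewrite -eo /hdot; congr dotmx; apply/rowP => l; rewrite !mxE.
Qed.

Lemma Rcomplex_scale (R : rcfType) (a : R) (x : R[i]) :
  a *: (x : Rcomplex R) = a%:C%C * x.
Proof.
by case: x => b c; apply/eqP; rewrite eq_complex /= !mul0r subr0 addr0 !eqxx.
Qed.

(* Division-free barycenter: [y] is the weighted mean when the total weight is
   nonzero, an arbitrary point of [S] otherwise. *)
Lemma convex_set_bary (R : realFieldType) (M : lmodType R)
    (S : set (convex_lmodType M)) (I : Type) (r : seq I) (t : I -> R)
    (x : I -> M) (x0 : M) :
  convex_set S -> S x0 -> (forall i, 0 <= t i) -> (forall i, S (x i)) ->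
  exists2 y : M, S y & \sum_(i <- r) t i *: x i = (\sum_(i <- r) t i) *: y.
Proof.
move=> cS Sx0 t0 Sx; elim: r => [|i r [y Sy IH]].
  by exists x0; rewrite // !big_nil scale0r.
rewrite !big_cons IH; set T := \sum_(j <- r) t j.
have T0 : 0 <= T by apply: sumr_ge0.
have [/eqP|TN0] := eqVneq (t i + T) 0.
  rewrite paddr_eq0 // => /andP[/eqP-> /eqP->].
  by exists y; rewrite // !scale0r !addr0 scale0r.
have Tgt0 : 0 < t i + T by rewrite lt_neqAle eq_sym TN0 addr_ge0.
have p0 : 0 <= t i / (t i + T) by rewrite divr_ge0 // ltW.
have p1 : t i / (t i + T) <= 1 by rewrite ler_pdivrMr // mul1r lerDl.
have := cS (x i) y (Itv01 p0 p1); rewrite !inE => /(_ (Sx i) Sy) Sz.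
eexists; first exact: Sz.
rewrite /conv /= scalerDr !scalerA /unstable.onem mulrBr mulr1 mulrCA.
rewrite divff // mulr1.
by rewrite [t i + T]addrC addrK.
Qed.

Lemma eigenvalue_compression_hull (R : realType) (m n : nat) (A : 'M[R[i]]_n)
    (E : 'M[R[i]]_(m, n)) (a : R[i]) :
  A \is normalmx -> E \is unitarymx -> eigenvalue (E *m A *m E^t*) a ->
  convex_hull [set` Eig A] a.
Proof.
move=> /orthomx_spectralP; set P := spectralmx A; set d := spectral_diag A.
have Pu : P \is unitarymx by exact: spectral_unitarymx.
rewrite invmx_unitary // => AE Eu /eigenvalueP[v vE v0] S /= [cS AS].
(* The rows of [P] are unit left eigenvectors of [A], so [S], an arbitrary convex set containing the
   spectrum, contains each [d 0 j]. *)
have SC j : S (d 0 j).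
  apply: AS; rewrite /= mem_Eig; apply/eigenvalueP; exists (row j P).
    rewrite {1}AE !mulmxA -row_mul (unitarymxP Pu) -row_mul mul1mx.
    by rewrite row_diag_mx -scalemxAl -rowE.
  apply/eqP => Pj0; have /row_unitarymxP/(_ j j) := Pu.
  by rewrite Pj0 linear0l eqxx => /esym/eqP; rewrite oner_eq0.
(* Coordinates of the vector [v *m E] in the eigenbasis formed by the rows of [P]. Here [v] is not
   normalised. *)
pose y := v *m E *m P^t*.
have yy : y *m y^t* = v *m v^t*.
  rewrite /y !trmx_mul !map_mxM !mulmxA trmxCK mulmxKtV //.
  by rewrite mulmxtVK.
have ydy : y *m diag_mx d *m y^t* = a *: (v *m v^t*).
  rewrite scalemxAl -vE [in RHS]AE /y !trmx_mul !map_mxM trmxCK.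
  by rewrite !mulmxA.
have vv0 : (v *m v^t*) 0 0 != 0 by rewrite -dotmxE dnorm_eq0.
(* This index supplies the default point [d 0 j0] of [S] for the barycenter. *)
have /rV0Pn[j0 _] : y != 0.
  by apply: contraNneq vv0 => y0; rewrite -yy y0 mul0mx mxE.
(* Convexity takes weights in [R], whereas squared moduli are typed in [R[i]]. *)
pose t j : R := complex.Re (`|y 0 j| ^+ 2).
have tE j : (t j)%:C%C = `|y 0 j| ^+ 2.
  by rewrite RRe_real // rpredX // normr_real.
have t0 j : 0 <= t j by rewrite -lecR tE exprn_ge0.
have [b Sb] := convex_set_bary _ (Rcomplex R) S _ (index_enum 'I_n) t (d 0)
  (d 0 j0) cS (SC j0) t0 SC.
rewrite Rcomplex_scale rmorph_sum /=.
under eq_bigr do rewrite Rcomplex_scale tE.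
under [in X in _ = X]eq_bigr do rewrite tE.
have -> : \sum_j `|y 0 j| ^+ 2 = (v *m v^t*) 0 0.
  by rewrite -yy mxE; apply: eq_bigr => j _; rewrite !mxE normCK.
have -> : \sum_j `|y 0 j| ^+ 2 * d 0 j = a * (v *m v^t*) 0 0.
  have /matrixP/(_ 0 0) := ydy; rewrite [in RHS]mxE => <-; rewrite mxE.
  by apply: eq_bigr => j _; rewrite mul_mx_diag !mxE normCK mulrAC.
(* Cancelling the nonzero total weight [v *m v^t*] identifies [a] with the barycenter. *)
by rewrite mulrC => /(mulfI vv0) ->.
Qed.

Theorem theorem3p4 (R : realType) (n : nat) (hn : (2 <= n)%N)
    (A : 'M[R[i]]_n) (hA : A \is normalmx) :
  (forall (z : 'I_n -> R[i]) (e : 'I_n -> 'cV[R[i]]_n),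
     perm_eq (Eig A) [seq z j | j : 'I_n] ->
     orthonormal_basis e ->
     (forall j : 'I_n, A *m e j = z j *: e j) ->
     forall (w : R[i]) (i : 'I_n), w \notin Eig A ->
       \det (principal_submx A i - w%:M) / \det (A - w%:M) =
       \sum_(j < n) `|hdot (delta_mx i 0) (e j)| ^+ 2 / (z j - w)) /\
  (forall i : 'I_n,
     [set` Eig (principal_submx A i)] `<=` convex_hull [set` Eig A]).
Proof.
split.
  move=> z e Az eo eE w i wA.
  pose P : 'M[R[i]]_n := \matrix_(k, j) e j k 0.
  have Pu : P \is unitarymx by exact: orthonormal_basis_unitarymx.
  have zw j : z j - w != 0.
    apply: contraNneq wA => /eqP; rewrite subr_eq0 => /eqP <-.
    by rewrite (perm_mem Az) map_f // mem_enum.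
  have AP : (A - w%:M) *m P = P *m diag_mx (\row_j (z j - w)).
    apply/matrixP => k j; rewrite mulmxBl mul_mx_diag mul_scalar_mx !mxE.
    have /matrixP/(_ k 0) := eE j; rewrite !mxE => AE.
    under eq_bigr do rewrite mxE.
    by rewrite AE mulrBr mulrC [w * _]mulrC.
  pose N := P *m diag_mx (\row_j (z j - w)^-1) *m P^t*.
  have AN : (A - w%:M) *m N = 1%:M.
    rewrite /N !mulmxA AP -[P *m _ *m _]mulmxA mulmx_diag.
    rewrite (_ : diag_mx _ = 1%:M) ?mulmx1 ?(unitarymxP Pu) //.
    by apply/matrixP => j k; rewrite !mxE mulfV.
  rewrite -principal_submxB_scalar (det_principal_submx_inv _ _ _ N) //.
  rewrite mulrC mulKr; last first.
    by rewrite -unitmxE; case/mulmx1_unit: AN.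
  (* The product with [delta_mx i 0] leaves the conjugate of [e j i 0], which has the same modulus
     as the entry of [P]. *)
  rewrite mxE; apply: eq_bigr => j _.
  rewrite mul_mx_diag !mxE hdotE (bigD1 i) //= big1 ?addr0.
    by rewrite !mxE !eqxx mul1r norm_conjC normCK mulrAC.
  by move=> k ki; rewrite !mxE (negbTE ki) mul0r.
move=> i a; rewrite /= mem_Eig principal_submx_compression => ea.
(* The entries are 0 and 1, so conjugation is harmless and the compression takes the form
   [E *m A *m E^t*]. *)
have Et : (row' i 1%:M)^t* = col' i 1%:M :> 'M[R[i]]_(n, n.-1).
  by rewrite tr_row' trmx1 map_col' map_mx1.
rewrite -Et in ea.
exact: (eigenvalue_compression_hull R _ _ A _ a hA (row'1_unitarymx _ _ i) ea).
Qed.
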